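(* Let $q\ge3$ be a prime power and $N\ge1$. Let $a,a_1,a_2$ be integers with $0\le a_1\le q^2-q-1$, $0\le a_2\le q$, $0\le a<a_2$ and $$q(q+1)=a+3a_1+2a_2 .$$ Then for a $(q^2+1,3,N)$ hotplug coded caching system the memory-rate point $$\left(\frac MN,R\right)=\left(\frac{q(q+1)}{3(a_1+a_2)},\ \frac{3(a_1+a_2)-q(q+1)}{3(a_1+a_2)}\right)$$ is achievable and optimal (it meets the cut-set bound).
   Context: Hotplug coded caching. In a $(K,K',N)$ hotplug coded caching system ($K'\le K$) a server stores $N$ files $W_1,\dots,W_N$, each of size $L$ bits (for a suitable $L$, so that files can be split and MDS-coded as needed), and is connected to $K$ users by an error-free shared link; each user has a cache of size $M$ files ($ML$ bits). In the placement phase the server fills the caches with functions of the files, knowing $K'$ but neither the identity of the $K'$ users who will be active nor the demands. In the delivery phase an arbitrary set $I\subseteq\{1,\dots,K\}$, $|I|=K'$, of active users reveals arbitrary demands $(d_i)_{i\in I}\in\{1,\dots,N\}^{I}$; the server broadcasts a message of size $RL$ bits, depending on the files, $I$ and the demands, such that each active user $i$ recovers $W_{d_i}$ from the message and its own cache. $R$ is the rate. The scheme must work for all files, all $I$ and all demands. A pair $(M/N,R)$ is achievable if such a scheme exists. Cut-set bound: every scheme with cache size $0\le M\le N$ has rate $R\ge\max_{s\in\{1,\dots,\min\{N,K'\}\}}\left(s-\frac{s}{\lfloor N/s\rfloor}M\right)$. A point is optimal if it is achievable and no scheme with the same $M$ has smaller rate; here it meets the cut-set bound in that $R=1-\frac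 MN$ (the term $s=1$). *)

(* Defs.v *)
From HB Require Import structures.
From mathcomp Require Import all_boot all_order all_algebra.
Set Implicit Arguments.
Unset Strict Implicit.
Unset Printing Implicit Defensive.
Import Order.TTheory GRing.Theory Num.Theory.
Local Open Scope ring_scope.

Definition prime_power (q : nat) : Prop :=
  exists p k : nat, [/\ prime p, (0 < k)%N & q = (p ^ k)%N].

Definition bits (n : nat) : Type := n.-tuple bool.

Definition library (N L : nat) : Type := {ffun 'I_N -> bits L}.

(* Only the active users have a demand. *)
Definition demands (K N : nat) (I : {set 'I_K}) : Type :=
  {ffun {i : 'I_K | i \in I} -> 'I_N}.

(* A scheme with L-bit files, m-bit caches and r-bit broadcasts. The placement
   depends on neither I nor d. Both are public during delivery, so the decoder
   of user i may depend on them, but on the files only through the broadcast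
   and the cache of i. *)
Record hotplug_scheme (K K' N L m r : nat) : Type := HotplugScheme {
  placement : 'I_K -> library N L -> bits m;
  delivery : forall I : {set 'I_K}, demands N I -> library N L -> bits r;
  decoding : forall I : {set 'I_K}, demands N I -> {i : 'I_K | i \in I} ->
    bits r -> bits m -> bits L;
  decodingP : forall (I : {set 'I_K}) (d : demands N I)
      (i : {i : 'I_K | i \in I}) (W : library N L),
    #|I| = K' ->
    decoding d i (delivery d W) (placement (val i) W) = W (d i) }.

(* x is the normalized memory M / N, so a cache has M L = x N L bits. Memories
   and rates are ratios of numbers of bits, hence rational. *)
Definition achievable (K K' N : nat) (x R : rat) : Prop :=
  exists L m r : nat,
    [/\ (0 < L)%N, m%:R = x * N%:R * L%:R, r%:R = R * L%:R &
        inhabited (hotplug_scheme K K' N L m r)].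

Definition optimal (K K' N : nat) (x R : rat) : Prop :=
  achievable K K' N x R /\
  forall R' : rat, achievable K K' N x R' -> R <= R'.

(* The default value of the maximum is its term s = 1. *)
Definition cutset_bound (K' N : nat) (M : rat) : rat :=
  \big[Num.max/1 - M / N%:R]_(1 <= s < (minn N K').+1)
     (s%:R - s%:R / (N %/ s)%:R * M).

(* Main.v *)
(* No block design is needed. Put e = a2 - a, so that the point is
   (1 - R, R) with R = e / (q(q+1) + e) <= 1/3, and time-share between (1, 0)
   and (2/3, 1/3). The latter is reached over a field with distinct elements
   x_1, ..., x_K: a file is a triple (w0, w1, w2), user i caches w1 - x_i w0
   and w2 - x_i w1 for each file, and the server sends the sum over the active
   users i of w2 - (x_j + x_l) w1 + x_j x_l w0, where w is the file wanted by i
   and j, l are the other two active users. Reading w as the functional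
   X^n |-> w_n on polynomials of degree at most 2, user i knows it on the
   multiples of X - x_i, and the term of i is its value at (X - x_j)(X - x_l):
   users j and l can compute this term, and it completes the knowledge of i. *)
Require Import Defs.
From HB Require Import structures.
From mathcomp Require Import all_boot all_order all_algebra all_field.
From mathcomp Require Import ring lra zify.
Set Implicit Arguments.
Unset Strict Implicit.
Unset Printing Implicit Defensive.
Import Order.TTheory GRing.Theory Num.Theory.
Local Open Scope ring_scope.

Lemma card_bits (n : nat) : #|{: bits n}| = (2 ^ n)%N.
Proof. by rewrite card_tuple card_bool. Qed.

Lemma eq_card_bij (A B : finType) :
  #|A| = #|B| -> exists f : A -> B, bijective f.
Proof.
move=> eqAB; exists (enum_val \o cast_ord eqAB \o enum_rank).
exists (enum_val \o cast_ord (esym eqAB) \o enum_rank) => x /=;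
  by rewrite enum_valK ?cast_ordK ?cast_ordKV enum_rankK.
Qed.

(** Bijections with bit strings carry a scheme over alphabets of sizes 2^L, 2^m and 2^r to one in
    bits, so field symbols can be used below. *)
Lemma scheme_of_alphabets (K K' N L m r : nat) (A C X : finType)
    (place : 'I_K -> {ffun 'I_N -> A} -> C)
    (deliver : forall I : {set 'I_K}, demands N I -> {ffun 'I_N -> A} -> X)
    (decode : forall I : {set 'I_K}, demands N I -> {i : 'I_K | i \in I} ->
       X -> C -> A) :
  #|A| = (2 ^ L)%N -> #|C| = (2 ^ m)%N -> #|X| = (2 ^ r)%N ->
  (forall (I : {set 'I_K}) (d : demands N I) (i : {i : 'I_K | i \in I})
     (W : {ffun 'I_N -> A}), #|I| = K' ->
     decode I d i (deliver I d W) (place (val i) W) = W (d i)) ->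
  inhabited (hotplug_scheme K K' N L m r).
Proof.
rewrite -!card_bits => /eq_card_bij[fA [gA fAK gAK]].
move=> /eq_card_bij[fC [gC fCK gCK]] /eq_card_bij[fX [gX fXK gXK]] decodeP.
pose sym (W : library N L) := [ffun n => gA (W n)].
constructor; apply: (@HotplugScheme K K' N L m r
  (fun i W => fC (place i (sym W)))
  (fun I d W => fX (deliver I d (sym W)))
  (fun I d i x c => fA (decode I d i (gX x) (gC c)))) => I d i W cardI.
by rewrite fXK fCK decodeP // ffunE gAK.
Qed.

Section SymbolScheme.

Variables (F : fieldType) (K : nat) (y : 'I_K -> F).

Definition cached (x : F) (w : F * F * F) : F * F :=
  (w.1.2 - x * w.1.1, w.2 - x * w.1.2).

(* The value at prod_(j in J) (X - y_j), for #|J| = 2, of the linear functional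
   X^n |-> w_n on polynomials of degree at most 2. *)
Definition piece (J : {set 'I_K}) (w : F * F * F) : F :=
  w.2 - (\sum_(j in J) y j) * w.1.2 + (\prod_(j in J) y j) * w.1.1.

(* Equals piece (u |: J) w for c = cached (y u) w and #|J| = 1. *)
Definition cached_piece (J : {set 'I_K}) (c : F * F) : F :=
  c.2 - (\sum_(j in J) y j) * c.1.

(** For [J] = {u, l}, (X - y_u)(X - y_l) = X (X - y_u) - y_l (X - y_u), and the cache holds the
    values at X - y_u and X (X - y_u). *)
Lemma cached_pieceE (J : {set 'I_K}) (u : 'I_K) (w : F * F * F) :
  u \in J -> #|J| = 2 -> cached_piece (J :\ u) (cached (y u) w) = piece J w.
Proof.
move=> uJ cardJ; rewrite /cached_piece /piece /cached !(big_setD1 u uJ) /=.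
have /eqP/cards1P[l ->] : #|J :\ u| = 1 by rewrite (cardsD1 u) uJ in cardJ; case: cardJ.
by rewrite !big_set1; ring.
Qed.

(** For [J] = {j, l}, (X - y_j)(X - y_l) is (X - y_u)(X + y_u - y_j - y_l) plus the constant (y_u -
    y_j)(y_u - y_l). The cache gives the value at the first summand; dividing the rest of [z] by the
    constant gives [w0]. *)
Definition uncache (J : {set 'I_K}) (u : 'I_K) (z : F) (c : F * F) : F * F * F :=
  let w0 := (z - c.2 - (y u - \sum_(j in J) y j) * c.1)
              / \prod_(j in J) (y u - y j) in
  let w1 := c.1 + y u * w0 in (w0, w1, c.2 + y u * w1).

Lemma uncacheK (J : {set 'I_K}) (u : 'I_K) (w : F * F * F) :
  injective y -> u \notin J -> #|J| = 2 ->
  uncache J u (piece J w) (cached (y u) w) = w.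
Proof.
move=> y_inj uJ /eqP/cards2P[j [l [jl defJ]]].
rewrite defJ !inE negb_or in uJ; case/andP: uJ => uj ul.
rewrite /uncache /piece /cached defJ; case: w => [[w0 w1] w2] /=.
rewrite !big_setU1 ?inE //= !big_set1.
have nz k : u != k -> y u - y k != 0.
  by rewrite subr_eq0 (inj_eq y_inj).
have -> : (w2 - (y j + y l) * w1 + y j * y l * w0 - (w2 - y u * w1)
   - (y u - (y j + y l)) * (w1 - y u * w0)) / ((y u - y j) * (y u - y l)) = w0.
  by field; rewrite !nz.
by congr (_, _, _); ring.
Qed.

Variables (N : nat) (I : {set 'I_K}) (d : demands N I).

Definition broadcast (W : 'I_N -> F * F * F) : F :=
  \sum_i piece (I :\ val i) (W (d i)).

Definition decode_symbol (u : {i : 'I_K | i \in I}) (z : F)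
    (c : 'I_N -> F * F) : F * F * F :=
  let others := \sum_(i | i != u)
    cached_piece (I :\ val i :\ val u) (c (d i)) in
  uncache (I :\ val u) (val u) (z - others) (c (d u)).

Lemma decode_symbolK (u : {i : 'I_K | i \in I}) (W : 'I_N -> F * F * F) :
  injective y -> #|I| = 3 ->
  decode_symbol u (broadcast W) (fun n => cached (y (val u)) (W n)) = W (d u).
Proof.
move=> y_inj cardI.
have card2 (i : {i : 'I_K | i \in I}) : #|I :\ val i| = 2.
  by move: cardI; rewrite (cardsD1 (val i)) (valP i) => -[].
rewrite /decode_symbol /broadcast (bigD1 u) //=.
rewrite [X in _ + _ - X](_ : _ = \sum_(i | i != u) piece (I :\ val i) (W (d i))).
  by rewrite addrK uncacheK ?card2 // !inE eqxx.
apply: eq_bigr => i iu; apply: cached_pieceE; last exact: card2.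
by rewrite !inE (valP u) andbT (inj_eq val_inj) eq_sym.
Qed.

End SymbolScheme.

(* Time sharing between the point (2/3, 1/3) on [e] triples of symbols and the
   point (1, 0) on [f] symbols that every user caches. *)
Lemma achievable_three_active (K N e f : nat) : (0 < e + f)%N ->
  achievable K 3 N ((2 * e + f)%:R / (3 * e + f)%:R) (e%:R / (3 * e + f)%:R).
Proof.
(* A symbol has [s] bits: a field with 2^s elements has room for K distinct points, and K + 1 stays
   positive when K = 0. *)
move=> ef_gt0; pose s := K.+1.
have [F _ cardF] := pPrimePowerField (isT : prime 2) (ltn0Sn K).
have leKF : (K <= #|F|)%N.
  by rewrite cardF; apply/ltnW/(leq_trans (ltn_expl K (ltnSn 1)))/leq_pexp2l.
pose y (i : 'I_K) : F := enum_val (widen_ord leKF i).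
have y_inj : injective y by move=> i j /enum_val_inj[/ord_inj].
have ef3_gt0 : (0 < 3 * e + f)%N by lia.
have ef3_neq0 : (3 * e + f)%:R != 0 :> rat by rewrite pnatr_eq0 -lt0n.
exists ((3 * e + f) * s)%N, (N * ((2 * e + f) * s))%N, (e * s)%N; split.
- by rewrite muln_gt0 ef3_gt0.
- by rewrite !natrM; field; rewrite -natrM -natrD.
- by rewrite !natrM; field; rewrite -natrM -natrD.
pose A : finType := ({ffun 'I_e -> F * F * F} * {ffun 'I_f -> F})%type.
pose C : finType := {ffun 'I_N -> {ffun 'I_e -> F * F} * {ffun 'I_f -> F}}.
apply: (@scheme_of_alphabets K 3 N _ _ _ A C {ffun 'I_e -> F}
  (fun i W => [ffun n => ([ffun t => cached (y i) ((W n).1 t)], (W n).2)])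
  (fun I d W => [ffun t => broadcast y d (fun n => (W n).1 t)])
  (fun I d u z c =>
     ([ffun t => decode_symbol y d u (z t) (fun n => (c n).1 t)], (c (d u)).2))).
- rewrite card_prod !card_ffun !card_prod !card_ord cardF -!expnD -!expnM -expnD.
  by congr (_ ^ _)%N; rewrite /s; ring.
- rewrite card_ffun card_prod !card_ffun !card_prod !card_ord cardF.
  by rewrite -!expnD -!expnM -expnD -expnM; congr (_ ^ _)%N; rewrite /s; ring.
- by rewrite card_ffun card_ord cardF -expnM mulnC.
move=> I d u W cardI /=; rewrite ffunE /=.
case defW: (W (d u)) => [w1 w2] /=; congr (_, _); apply/ffunP=> t.
have -> : w1 = (W (d u)).1 by rewrite defW.
rewrite !ffunE -(decode_symbolK d u (fun n => (W n).1 t) y_inj cardI).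
rewrite /decode_symbol; congr uncache; last by rewrite !ffunE.
by congr (_ - _); apply: eq_bigr => i _; rewrite !ffunE.
Qed.

(* One cache and the N broadcasts that serve its user each of the N files
   determine the library. *)
Lemma achievable_ge (K K' N : nat) (x R : rat) :
  (0 < N)%N -> (0 < K' <= K)%N -> achievable K K' N x R -> 1 - x <= R.
Proof.
move=> N_gt0 /andP[K'_gt0 leK'K] [L [m [r [L_gt0 defm defr [S]]]]].
pose I : {set 'I_K} := [set widen_ord leK'K i | i : 'I_K'].
have cardI : #|I| = K'.
  by rewrite card_imset ?card_ord // => i j [/ord_inj].
have uI : widen_ord leK'K (Ordinal K'_gt0) \in I by apply: imset_f.
pose u : {i : 'I_K | i \in I} := exist (fun i => i \in I) _ uI.
pose dem n : demands N I := [ffun=> n].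
pose view (W : library N L) : bits m * {ffun 'I_N -> bits r} :=
  (placement S (val u) W, [ffun n => delivery S (dem n) W]).
have view_inj : injective view.
  move=> W1 W2 [eq_cache /ffunP eq_msg]; apply/ffunP=> n.
  have:= eq_msg n; rewrite !ffunE => eq_n.
  have:= decodingP S (dem n) u W1 cardI; have:= decodingP S (dem n) u W2 cardI.
  by rewrite eq_cache eq_n ffunE => -> ->.
have:= leq_card _ view_inj.
(* Comparing exponents of 2 yields N L <= m + N r. *)
rewrite card_prod !card_ffun !card_bits card_ord -!expnM -expnD leq_exp2l //.
rewrite -(ler_nat rat) natrD !natrM defm defr => le_size.
have NL_gt0 : 0 < N%:R * L%:R :> rat by rewrite -natrM ltr0n muln_gt0 N_gt0.
by rewrite lerBlDl -(ler_pM2r NL_gt0); lra.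
Qed.

(** Since s floor(N/s) <= N, term s is at most s - s^2 x, and 1 - x minus this is (s - 1)((s + 1) x
    - 1) >= 0. *)
Lemma cutset_bound_first_term (K' N : nat) (x : rat) :
  (0 < N)%N -> 1 / 3%:R <= x -> cutset_bound K' N (x * N%:R) = 1 - x.
Proof.
move=> N_gt0 x_ge; have N_neq0 : N%:R != 0 :> rat by rewrite pnatr_eq0 -lt0n.
rewrite /cutset_bound mulfK //; apply/eqP; rewrite eq_le bigmax_ge_id andbT.
rewrite big_seq; apply: bigmax_le => // s.
rewrite mem_index_iota ltnS leq_min => /and3P[s_gt0 le_sN _].
have t_gt0 : (0 < N %/ s)%N by rewrite divn_gt0.
have st_le : (s * (N %/ s))%:R <= N%:R :> rat by rewrite ler_nat mulnC leq_trunc_div.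
have s2x_le : s%:R ^+ 2 * x <= s%:R / (N %/ s)%:R * (x * N%:R).
  rewrite [leRHS]mulrAC ler_pdivlMr ?ltr0n // expr2.
  move: st_le; rewrite natrM.
  have : 0 <= s%:R * x by rewrite mulr_ge0 //; lra.
  nra.
case: s s_gt0 {le_sN t_gt0 st_le} s2x_le => [//|[|s] _]; first by lra.
rewrite -addn2 natrD; have := ler0n rat s; nra.
Qed.

Theorem theorem8 (q N a a1 a2 : nat)
  (q_pp : prime_power q) (q_ge3 : (3 <= q)%N) (N_ge1 : (1 <= N)%N)
  (a1_le : (a1 <= q ^ 2 - q - 1)%N) (a2_le : (a2 <= q)%N) (a_lt : (a < a2)%N)
  (q_eq : (q * (q + 1) = a + 3 * a1 + 2 * a2)%N) :
  let x : rat := (q * (q + 1))%:R / (3 * (a1 + a2))%:R in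
  let R : rat :=
    ((3 * (a1 + a2))%:R - (q * (q + 1))%:R) / (3 * (a1 + a2))%:R in
  [/\ achievable (q ^ 2 + 1) 3 N x R,
      optimal (q ^ 2 + 1) 3 N x R,
      R = cutset_bound 3 N (x * N%:R) &
      R = 1 - x].
Proof.
(* By [q_eq], 3 (a1 + a2) - q (q + 1) = a2 - a, so [e] is the numerator of [R]. *)
move=> x R; pose e := (a2 - a)%N; pose f := (q * (q + 1) - 2 * e)%N.
have le_e : (2 * e <= q * (q + 1))%N by rewrite /e; nia.
have def_n : (q * (q + 1) = 2 * e + f)%N by rewrite /f; lia.
have def_k : (3 * (a1 + a2) = 3 * e + f)%N by rewrite /f /e; lia.
have k_gt0 : (0 < 3 * (a1 + a2))%N by lia.
have k_neq0 : (3 * (a1 + a2))%:R != 0 :> rat by rewrite pnatr_eq0 -lt0n.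
have ach : achievable (q ^ 2 + 1) 3 N x R.
  have -> : R = e%:R / (3 * e + f)%:R.
    rewrite /R def_k def_n -natrB; last by lia.
    by congr (_%:R / _); lia.
  rewrite /x def_k def_n; apply: achievable_three_active; rewrite /e; lia.
have defR : R = 1 - x by rewrite /R /x mulrBl divff.
split=> //.
- split=> // R' /achievable_ge; rewrite defR; apply=> //; nia.
- rewrite cutset_bound_first_term // /x ler_pdivlMr ?ltr0n //.
  have : (3 * (a1 + a2) <= 3 * (q * (q + 1)))%N by lia.
  by rewrite -(ler_nat rat) natrM [X in _ <= X]natrM; lra.
Qed.
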